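(* Let $A$ be an integral domain and $E$ an $A$-module. Then $qD_A(E)$ is a $T_1$-space if and only if $E$ is a quasi second $A$-module.
   Context: For an $A$-module $E$: $\operatorname{ann}(E)=\{a\in A: aE=0\}$, $W(E)=\{a\in A: aE\neq E\}$, $W(E)^{\#}=W(E)\setminus\operatorname{ann}(E)$. On $W(E)^{\#}$ put $a\sim b$ iff $aE=bE$; $[a]$ is the class of $a$ and $\operatorname{EC}(W(E)^{\#})$ is the set of all classes. For $a\in W(E)^{\#}$, $U_a=\{[b]\in\operatorname{EC}(W(E)^{\#}): aE\subseteq bE\}$. The quasi divisor topology $qD_A(E)$ is the topological space $\operatorname{EC}(W(E)^{\#})$ whose topology has basis $\{U_a\}_{a\in W(E)^{\#}}$. $E$ is a quasi second module if for all $a,b\in A$, $0\neq bE\subseteq aE\neq E$ implies $bE=aE$. *)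

(* Defs.v *)
From HB Require Import structures.
From mathcomp Require Export all_boot all_order all_algebra.
From mathcomp Require Export all_classical.
From mathcomp Require Export topology.

Set Implicit Arguments.
Unset Strict Implicit.
Unset Printing Implicit Defensive.

Import GRing.Theory.
Local Open Scope classical_set_scope.
Local Open Scope ring_scope.
Local Open Scope quotient_scope.

Section QuasiDivisor.
Context {A : comNzRingType} (E : lmodType A).

Definition smulE (a : A) : set E := [set a *: x | x in [set: E]].

Definition ann : set A := [set a | smulE a = [set 0]].

Definition W : set A := [set a | smulE a <> [set: E]].

Definition Wsharp : set A := W `\` ann.

Definition sim : rel Wsharp := fun a b : Wsharp =>
  `[< smulE (\val a) = smulE (\val b) >].

Lemma sim_refl : reflexive sim.
Proof. by move=> a; apply/asboolP. Qed.

Lemma sim_sym : symmetric sim.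
Proof. by move=> a b; apply/asboolP/asboolP. Qed.

Lemma sim_trans : transitive sim.
Proof. by move=> b a c /asboolP ab /asboolP bc; apply/asboolP; rewrite ab. Qed.

Canonical sim_equiv := EquivRel sim sim_refl sim_sym sim_trans.

Definition EC : Type := {eq_quot sim}.

HB.instance Definition _ := Choice.on EC.
HB.instance Definition _ := Quotient.on EC.
HB.instance Definition _ := EqQuotient.on EC.

Definition U (a : Wsharp) : set EC :=
  [set \pi_EC b | b in [set b : Wsharp | smulE (\val a) `<=` smulE (\val b)]].

Lemma mem_U (a b : Wsharp) :
  U a (\pi_EC b) <-> smulE (\val a) `<=` smulE (\val b).
Proof.
split=> [[c /= ac /eqmodP/asboolP <- //]|ab]; by exists b.
Qed.

Definition qD : Type := EC.

HB.instance Definition _ := Choice.on qD.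
HB.instance Definition _ := Quotient.on qD.

Lemma bigcup_U : \bigcup_(B in range U) B = [set: EC].
Proof.
apply/seteqP; split=> // c _; exists (U (repr c)); first by exists (repr c).
by rewrite -{2}[c]reprK; apply/mem_U.
Qed.

Lemma U_join (B C : set EC) (c : EC) : range U B -> range U C -> B c -> C c ->
  exists D : set EC, [/\ range U D, D c & D `<=` B `&` C].
Proof.
move=> [a _ <-] [b _ <-]; rewrite -[c]reprK => /mem_U ac /mem_U bc.
exists (U (repr c)); split; [by exists (repr c)|exact/mem_U|].
move=> d; rewrite -[d]reprK => /mem_U cd.
by split; apply/mem_U; [apply: subset_trans ac cd|apply: subset_trans bc cd].
Qed.

(* The index type of the basis has to be pointed, whereas Wsharp may be empty,
   so the basis {U_a} is indexed by its own members. *)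
HB.instance Definition _ :=
  @isBaseTopological.Build qD (set EC) (range U) id bigcup_U U_join.

Lemma open_qDE (O : set qD) :
  open O <-> exists D : set Wsharp, O = \bigcup_(a in D) U a.
Proof.
split.
- move=> [D' sD' <-]; exists [set a | D' (U a)].
  apply/seteqP; split=> [c [B D'B Bc]|c [a Da ac]]; last by exists (U a).
  have [a _ aB] := sD' _ D'B; exists a; by rewrite /= aB.
- move=> [D ->]; apply: bigcup_open => a _.
  exists [set U a]; last by rewrite bigcup_set1.
  by move=> _ ->; exists a.
Qed.

Definition quasi_second : Prop := forall a b : A,
  smulE b <> [set 0] -> smulE b `<=` smulE a -> smulE a <> [set: E] ->
  smulE b = smulE a.

End QuasiDivisor.

(* Main.v *)
Require Import Defs.

Local Open Scope classical_set_scope.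
Local Open Scope quotient_scope.

(** The set [U a] is not merely a basic open set but the smallest open
    neighbourhood of the class of [a]: a basic set [U c] contains this class
    exactly when [c E] is included in [a E], and then it contains all of [U a].
    Hence the space is T1 if and only if each [U a] contains only the class of
    [a], that is, if and only if an inclusion [a E] in [b E] between
    non-annihilating, non-surjective scalars is always an equality.  This is
    the quasi second condition, because in a chain of a nonzero [b E] included
    in a proper [a E] both submodules are automatically nonzero and proper, so
    both scalars name points of the space. *)

Lemma open_U (A : comNzRingType) (E : lmodType A) (a : Wsharp E) :
  open (U a : set (qD E)).
Proof. by apply/open_qDE; exists [set a]; rewrite bigcup_set1. Qed.

(** This is the minimality of [U a] among the open neighbourhoods of the class
    of [a]: an open set is a union of basic sets, and a basic set is closed
    under passing from a point to any point whose submodule is larger. *)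
Lemma open_subset_smulE (A : comNzRingType) (E : lmodType A)
    (O : set (qD E)) (a b : Wsharp E) :
  open O -> O (\pi_(EC E) a) -> @smulE A E (\val a) `<=` @smulE A E (\val b) ->
  O (\pi_(EC E) b).
Proof.
move=> /open_qDE[D ->] [c Dc /mem_U ca] ab.
by exists c => //; apply/mem_U; apply: subset_trans ab.
Qed.

(** If [a E] lies in [b E], an open set around the class of [a] also contains
    that of [b], so T1 forces the classes to be equal.  Conversely, if only
    trivial inclusions occur, [U a] misses every class but that of [a]. *)
Lemma accessible_qDP (A : comNzRingType) (E : lmodType A) :
  accessible_space (qD E) <->
  (forall a b : Wsharp E, @smulE A E (\val a) `<=` @smulE A E (\val b) ->
     @smulE A E (\val a) = @smulE A E (\val b)).
Proof.
split=> [T1 a b ab|maxE].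
  have [/eqmodP/asboolP //|ne] := eqVneq (\pi_(EC E) a) (\pi_(EC E) b).
  have [O [oO /set_mem Oa /set_mem nOb]] := T1 _ _ ne.
  by case: nOb; apply: open_subset_smulE ab.
move=> x y; rewrite -[x](@reprK _ (EC E)) -[y](@reprK _ (EC E)) => ne.
exists (U (repr (x : EC E))); split; first exact: open_U.
  exact/mem_set/mem_U.
apply/mem_set => /=.
move=> /mem_U /maxE xy; move/eqP: ne; apply.
by apply/eqmodP/asboolP.
Qed.

Lemma mem_smulE0 (A : comNzRingType) (E : lmodType A) (a : A) :
  @smulE A E a GRing.zero.
Proof. by exists GRing.zero => //; rewrite GRing.scaler0. Qed.

(** The quasi second condition speaks of arbitrary scalars; this restates it
    for those that name points of the space. *)
Lemma quasi_secondP (A : comNzRingType) (E : lmodType A) :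
  quasi_second E <->
  (forall a b : Wsharp E, @smulE A E (\val a) `<=` @smulE A E (\val b) ->
     @smulE A E (\val a) = @smulE A E (\val b)).
Proof.
split=> [qs a b ab|maxE a b b0 ba aT].
  have [_ a0] := set_mem (valP a); have [bT _] := set_mem (valP b).
  exact: qs.
(* Nonvanishing passes up from [b E] to [a E], properness passes down. *)
have Wa : a \in Wsharp E.
  apply/mem_set; split=> // a0; apply: b0; apply/seteqP; split.
    by rewrite -a0.
  by move=> _ ->; exact: mem_smulE0.
have Wb : b \in Wsharp E.
  apply/mem_set; split=> // bT; apply: aT; apply/seteqP; split=> // x _.
  by apply: ba; rewrite bT.
exact: (maxE (Sub b Wb) (Sub a Wa)).
Qed.

Theorem theorem13 (A : idomainType) (E : lmodType A) :
  accessible_space (qD E) <-> quasi_second E.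
Proof.
by split=> [/accessible_qDP /quasi_secondP|/quasi_secondP /accessible_qDP].
Qed.
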